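(* Let $G$ be a consistently locally constructible graph. Then $G$ is a weak cop win.
   Context: Graphs are undirected, loopless and connected. A vertex $u$ dominates a vertex $v\neq u$ in a graph if the set consisting of $v$ and all neighbours of $v$ is contained in the set consisting of $u$ and all neighbours of $u$. A finite graph $H$ is constructible with root $r$ and domination map $\delta\colon H\setminus\{r\}\to H$ if there is an ordering $x_1,\ldots,x_n$ of its vertices with $x_1=r$ such that for every $k>1$ we have $\delta(x_k)=x_i$ for some $i<k$, and $x_k$ is dominated by $\delta(x_k)$ in the induced graph $H[x_1,\ldots,x_k]$. A graph $G$ is consistently locally constructible if there is a nested (increasing) sequence of finite induced subgraphs $G_i$ of $G$ with $\bigcup_i G_i=G$, vertices $v_i\in G_i$, and maps $\delta_i\colon G_i\setminus\{v_i\}\to G_i$ such that: (1) each $G_i$ is constructible with domination map given by $\delta_i$ and root $v_i$; (2) the maps are consistent: if $v\in (G_i\setminus\{v_i\})\cap(G_j\setminus\{v_j\})$ then $\delta_i(v)=\delta_j(v)$. (The construction orders of the various $G_i$ are not required to be consistent.) Cops and robbers: on a graph $G$ the cop picks a starting vertex, then the robber picks a starting vertex; then they move alternately, with the cop moving first. At each turn the player moves to an adjacent vertex or does not move. The cop catches the robber if he lands on the robber's vertex. $G$ is a weak cop win if there is a strategy for the cop that guarantees that either the cop catches the robber or, for every vertex, the robber visits that vertex only finitely often. *)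

(* Defs.v *)
From mathcomp Require Import all_boot.
From mathcomp Require Import boolp classical_sets functions cardinality.
From Stdlib Require Import Relation_Operators.

Set Implicit Arguments.
Unset Strict Implicit.
Unset Printing Implicit Defensive.

Local Open Scope classical_set_scope.

Record graph := Graph {
  vertex :> Type;
  adj : vertex -> vertex -> Prop;
  adj_sym : forall x y, adj x y -> adj y x;
  adj_loopless : forall x, ~ adj x x;
  adj_connected : forall x y, clos_refl_trans vertex adj x y
}.

(* An induced subgraph G[A] is represented by its vertex set A. *)

Definition closed_nbhd (G : graph) (A : set G) (v : G) : set G :=
  [set w | A w /\ (w = v \/ adj v w)].

(* u dominates v in G[A]. *)
Definition dominates (G : graph) (A : set G) (u v : G) : Prop :=
  [/\ A u, A v, v <> u & closed_nbhd A v `<=` closed_nbhd A u].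

(* The vertex ordering is x 0, ..., x (n - 1), counted from 0.  The domination
   map is a total function of which only the values on A minus r matter; that
   it sends A minus r into A follows from d (x k) = x i. *)
Definition constructible (G : graph) (A : set G) (r : G) (d : G -> G) : Prop :=
  exists (n : nat) (x : nat -> G),
    [/\ (0 < n)%N, set_bij `I_n A x, x 0%N = r &
        forall k : nat, (0 < k < n)%N ->
          (exists2 i : nat, (i < k)%N & d (x k) = x i) /\
          dominates (x @` `I_k.+1) (d (x k)) (x k)].

(* The sequence H is nested but need not be strictly increasing, so that finite
   graphs are covered by constant sequences.  Connectedness of each G[H i] is
   not required separately: each x k is adjacent to the vertex dominating it. *)
Definition consistently_locally_constructible (G : graph) : Prop :=
  exists (H : nat -> set G) (v : nat -> G) (d : nat -> G -> G),
    [/\ forall i : nat, finite_set (H i) /\ H i (v i),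
        forall i : nat, H i `<=` H i.+1,
        \bigcup_i H i = [set: G],
        forall i : nat, constructible (H i) (v i) (d i) &
        forall (i j : nat) (x : G),
          (H i `\ v i) x -> (H j `\ v j) x -> d i x = d j x].

Definition legal_walk (G : graph) (p : nat -> G) : Prop :=
  forall n : nat, p n.+1 = p n \/ adj (p n) (p n.+1).

(* In a play, c n and r n are the positions of cop and robber after n complete
   rounds.  A strategy consists of a starting vertex c0 and a function move
   giving the next cop position from the history (c 0, r 0), ..., (c n, r n). *)
Definition cop_follows (G : graph) (c0 : G) (move : seq (G * G) -> G)
    (c r : nat -> G) : Prop :=
  c 0%N = c0 /\
  forall n : nat, c n.+1 = move (mkseq (fun i => (c i, r i)) n.+1).

(* The cop moves first in each round, so he lands on the robber when
   c n.+1 = r n.  A play ended by a capture is extended to an infinite one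
   (the robber may stay put), so only infinite robber walks are considered.
   Each round ending with the robber at v counts as a visit to v; in
   particular, staying at v forever visits v infinitely often. *)
Definition weak_cop_win (G : graph) : Prop :=
  exists (c0 : G) (move : seq (G * G) -> G),
    forall c r : nat -> G,
      cop_follows c0 move c r -> legal_walk r ->
      legal_walk c /\
      ((exists n : nat, c n.+1 = r n) \/
       (forall v : G, finite_set [set n | r n = v])).

(* Main.v *)
(* The domination maps combine into one map d on all of G.  The cop moves to the
   vertex d^j(r) with j least such that it is adjacent or equal to his position c,
   where r is the robber's position, and to d c if there is none.  Orbits of d
   merge, so if the robber keeps returning to x then the cop eventually sits on
   the orbit of the robber, and he stays there: retractions onto initial segments
   of a construction order preserve adjacency.  Within any finite constructible
   subgraph containing the walk, the predecessor of the cop on the orbit of the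
   robber moves strictly up in the construction order at each round.  Hence the
   distance j along the orbit at successive visits to x strictly decreases; it
   does not depend on the chosen subgraph, so there are finitely many visits. *)

Require Import Defs.
From mathcomp Require Import all_boot.
From mathcomp Require Import boolp classical_sets functions cardinality zify.

Set Implicit Arguments.
Unset Strict Implicit.
Unset Printing Implicit Defensive.

Local Open Scope classical_set_scope.

(** * Construction orders and their retractions *)

Definition cadj (G : graph) (x y : G) : Prop := y = x \/ adj x y.

Lemma cadjxx (G : graph) (x : G) : cadj x x.
Proof. by left. Qed.

Lemma cadj_sym (G : graph) (x y : G) : cadj x y -> cadj y x.
Proof. by case=> [->|/adj_sym]; [left|right]. Qed.

(* idx is the position in a construction order of A with root z and domination
   map d.  The value d z is unconstrained. *)
Record ranked (G : graph) (A : set G) (z : G) (d : G -> G) (idx : G -> nat) :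
    Prop := Ranked {
  ranked_root : A z;
  ranked_root0 : idx z = 0%N;
  ranked_in : forall x, A x -> x <> z -> A (d x);
  ranked_lt : forall x, A x -> x <> z -> (idx (d x) < idx x)%N;
  ranked_dom : forall x y, A x -> x <> z -> A y -> (idx y <= idx x)%N ->
    cadj x y -> cadj (d x) y }.

(** Allowing [e] to differ from [d] at the root lets one global map serve all subgraphs. *)
Lemma constructible_ranked (G : graph) (A : set G) (r : G) (d e : G -> G) :
  constructible A r d -> (forall x, A x -> x <> r -> e x = d x) ->
  exists idx : G -> nat, ranked A r e idx.
Proof.
move=> [n [x [n0 [xA xinj xsurj] x0 xd]]] ed.
have /choice[idx idxP] : forall y, exists k, A y -> (k < n)%N /\ x k = y.
  move=> y; have [/xsurj[k kn <-]|nAy] := pselect (A y); first by exists k.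
  by exists 0%N.
have idxK k : (k < n)%N -> idx (x k) = k.
  move=> kn; have [idxn /xinj] := idxP _ (xA k kn).
  by apply; rewrite inE.
have Ar : A r by rewrite -x0; apply: xA.
have dom y : A y -> y <> r -> (exists2 i, (i < idx y)%N & e y = x i) /\
    dominates (x @` `I_(idx y).+1) (e y) y.
  move=> Ay yr; rewrite ed//; have [yn xy] := idxP y Ay.
  have := xd (idx y); rewrite xy; apply; rewrite yn andbT lt0n.
  by apply: contra_notN yr => /eqP y0; rewrite -xy y0.
exists idx; split=> //.
- by rewrite -x0 idxK.
- move=> y Ay yr; have [[i iy ->] _] := dom y Ay yr.
  by apply: xA => /=; apply: ltn_trans iy _; case: (idxP y Ay).
- move=> y Ay yr; have [[i iy ->] _] := dom y Ay yr.
  by rewrite idxK//; apply: ltn_trans iy _; case: (idxP y Ay).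
- move=> y w Ay yr Aw wy yw; have [_ [_ _ _ sub]] := dom y Ay yr.
  have [] // : closed_nbhd (x @` `I_(idx y).+1) (e y) w.
  apply: sub; split=> //; exists (idx w); first by rewrite /= ltnS.
  by case: (idxP w Aw).
Qed.

Lemma ranked_gt0 (G : graph) (A : set G) (z : G) d idx x :
  ranked A z d idx -> (0 < idx x)%N -> x <> z.
Proof. by move=> rk + xz; rewrite xz (ranked_root0 rk). Qed.

Lemma ranked_iter (G : graph) (A : set G) (z : G) d idx x n :
  ranked A z d idx -> A x -> (forall b, (b < n)%N -> iter b d x <> z) ->
  A (iter n d x) /\ (idx (iter n d x) + n <= idx x)%N.
Proof.
move=> rk Ax; elim: n => [|n IH] nz; first by rewrite addn0.
have [|An le_n] := IH; first by move=> b bn; apply: nz; apply: ltnW.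
have nzn := nz n (ltnSn n).
split; first exact: (ranked_in rk An nzn).
by have /= := ranked_lt rk An nzn; lia.
Qed.

Lemma ranked_reach_root (G : graph) (A : set G) (z : G) d idx x :
  ranked A z d idx -> A x -> exists n, iter n d x = z.
Proof.
move=> rk; have [n] := ubnP (idx x); elim: n x => // n IH x xn Ax.
have [->|xz] := pselect (x = z); first by exists 0%N.
have [||m <-] := IH (d x); last by exists m.+1; rewrite iterSr.
  by have := ranked_lt rk Ax xz; lia.
exact: (ranked_in rk Ax xz).
Qed.

(* The retractions onto the initial segments of a construction order preserve
   adjacency-or-equality; here the segment ends at a point of the orbit of x. *)
Lemma ranked_retract (G : graph) (A : set G) (z : G) d idx x y a :
  ranked A z d idx -> A x -> A y -> cadj x y ->
  (forall b, (b <= a)%N -> iter b d x <> z) ->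
  exists j, [/\ A (iter j d y), cadj (iter a d x) (iter j d y),
    (idx (iter j d y) <= idx (iter a d x))%N &
    forall i, (i < j)%N -> (idx (iter a d x) < idx (iter i d y))%N].
Proof.
(* Induction on the sum of the indices: [d] is applied to a vertex that is not the earlier of the
   two, and [ranked_dom] keeps the pair adjacent or equal. *)
move=> rk; have [n] := ubnP (idx x + idx y).
elim: n x y a => // n IH x y a xyn Ax Ay xy nz.
have [] := ranked_iter (n := a) rk Ax; first by move=> b /ltnW; apply: nz.
move=> As s_le.
have move_y : (idx (iter a d x) < idx y)%N -> (idx x <= idx y)%N ->
  exists j, [/\ A (iter j d y), cadj (iter a d x) (iter j d y),
    (idx (iter j d y) <= idx (iter a d x))%N &
    forall i, (i < j)%N -> (idx (iter a d x) < idx (iter i d y))%N].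
  move=> sy x_le_y; have yz := ranked_gt0 rk (leq_ltn_trans (leq0n _) sy).
  have [] := IH x (d y) a _ Ax (ranked_in rk Ay yz) _ nz.
  - by have := ranked_lt rk Ay yz; lia.
  - apply: cadj_sym; apply: (ranked_dom rk Ay yz Ax x_le_y).
    exact: cadj_sym.
  - move=> j [Aj cj lej ltj]; exists j.+1; rewrite iterSr; split=> //.
    by case=> [|i] ij //; rewrite iterSr; apply: ltj.
have [y_s|s_y] := leqP (idx y) (idx (iter a d x)); last first.
  have [x_le_y|y_lt_x] := leqP (idx x) (idx y); first exact: move_y.
  case: a nz {As s_le move_y} s_y => [|a] nz s_y.
    by move: y_lt_x s_y => /=; lia.
  have xz := nz 0%N isT; rewrite /= in xz.
  rewrite iterSr; apply: IH => //.
  - by have := ranked_lt rk Ax xz; lia.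
  - exact: (ranked_in rk Ax xz).
  - exact: (ranked_dom rk Ax xz Ay (ltnW y_lt_x) xy).
  - by move=> b ba; rewrite -iterSr; apply: nz.
case: a nz {As move_y} s_le y_s => [|a] nz s_le y_s.
  by exists 0%N.
have xz := nz 0%N isT; rewrite /= in xz.
have y_le_x : (idx y <= idx x)%N by lia.
rewrite iterSr; apply: IH => //.
- by have := ranked_lt rk Ax xz; lia.
- exact: (ranked_in rk Ax xz).
- exact: (ranked_dom rk Ax xz Ay y_le_x xy).
- by move=> b ba; rewrite -iterSr; apply: nz.
Qed.

(** * A single domination map on the whole graph *)

Lemma finite_eventually (T : Type) (F : set T) (P : T -> nat -> Prop) :
  finite_set F ->
  (forall x, F x -> exists N, forall i, (N <= i)%N -> P x i) ->
  exists N, forall i, (N <= i)%N -> forall x, F x -> P x i.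
Proof.
move=> finF ev.
have /choice[N NP] : forall x, exists N, F x -> forall i, (N <= i)%N -> P x i.
  move=> x; have [/ev[N NP]|nFx] := pselect (F x); first by exists N.
  by exists 0%N.
have /finite_seqP[s sE] := finite_image N finF.
exists (\max_(k <- s) k)%N => i le_i x Fx; apply: NP => //.
apply: leq_trans le_i; apply: leq_bigmax_seq => //.
by have : [set` s] (N x) by rewrite -sE; exists x.
Qed.

(** The last clause controls the root, where [ranked] leaves [d] free: it lies outside [F] or is a
    fixed point. *)
Definition exhausted (G : graph) (d : G -> G) : Prop :=
  forall F : set G, finite_set F -> exists (A : set G) (z : G) (idx : G -> nat),
    [/\ F `<=` A, ranked A z d idx & F z -> d z = z].

(* If some vertex z is the root infinitely often, only the subgraphs rooted at
   z are used and d z = z; otherwise the root eventually avoids any given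
   finite set. *)
Lemma clc_exhausted (G : graph) :
  consistently_locally_constructible G -> exists d : G -> G, exhausted d.
Proof.
move=> [H [v [d [_ Hsub Hcov Hcon Hd]]]].
have Hmono i j : (i <= j)%N -> H i `<=` H j.
  move=> /subnK <-; elim: (j - i)%N => [|k IH] //.
  by apply: subset_trans IH _; exact: Hsub.
have [S [Sinf Sroot]] : exists S : set nat,
    (forall N, exists2 i, (N <= i)%N & S i) /\
    forall x, (forall i, S i -> v i = x) \/
      exists N, forall i, (N <= i)%N -> S i -> v i <> x.
  have [[z zP]|nex] := pselect (exists z, forall N, exists2 i, (N <= i)%N & v i = z).
    exists [set i | v i = z]; split=> // x.
    have [<-|zx] := pselect (z = x); first by left.
    by right; exists 0%N => i _ /= ->.
  exists setT; split=> [N|x]; first by exists N.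
  right; apply: contrapT => nx; apply: nex; exists x => N.
  apply: contrapT => nN; apply: nx; exists N => i Ni _ vx.
  by apply: nN; exists i.
(* By consistency [d i x] does not depend on [i]; a vertex that is the root for all of [S] is sent
   to itself. *)
have /choice[e eP] : forall x, exists y,
    (forall i, S i -> H i x -> x <> v i -> y = d i x) /\
    ((forall i, S i -> v i = x) -> y = x).
  move=> x; have [[i [Si Hi xi]]|nex] :=
    pselect (exists i, [/\ S i, H i x & x <> v i]).
    exists (d i x); split=> [j Sj Hj xj|/(_ _ Si)/esym //].
    exact: Hd.
  exists x; split=> // i Si Hi xi.
  by exfalso; apply: nex; exists i.
exists e => F finF.
have [|N NP] := finite_eventually
    (P := fun x i => S i -> H i x /\ (v i = x -> e x = x)) finF.
  move=> x Fx; have [i0 _ Hi0] : (\bigcup_i H i) x by rewrite Hcov.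
  have [/[dup] allx /(proj2 (eP x)) ex|[N NP]] := Sroot x.
    by exists i0 => i i0i Si; split=> //; apply: Hmono Hi0.
  exists (maxn i0 N) => i; rewrite geq_max => /andP[i0i Ni] Si.
  by split=> [|vx]; [apply: Hmono Hi0|have := NP i Ni Si].
have [i Ni Si] := Sinf N.
have [|idx rk] := constructible_ranked (e := e) (Hcon i).
  by move=> x Hx xv; apply: (proj1 (eP x)).
exists (H i), (v i), idx; split=> // [x Fx|Fv].
  by case: (NP i Ni x Fx Si).
by case: (NP i Ni _ Fv Si) => _; apply.
Qed.

Lemma exhausted_cadj (G : graph) (d : G -> G) (x : G) :
  exhausted d -> cadj x (d x).
Proof.
move=> /(_ _ (finite_set1 x))[A [z [idx [FA rk fz]]]].
have Ax : A x by exact: FA.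
have [xz|xz] := pselect (x = z); first by left; rewrite xz fz.
apply: cadj_sym; exact: (ranked_dom rk Ax xz Ax (leqnn _) (cadjxx x)).
Qed.

Lemma exhausted_merge (G : graph) (d : G -> G) (x y : G) :
  exhausted d -> exists m n, iter m d x = iter n d y.
Proof.
move=> /(_ _ (finite_set2 x y))[A [z [idx [FA rk _]]]].
have [|m mz] := ranked_reach_root (x := x) rk; first by apply: FA; left.
have [|n nz] := ranked_reach_root (x := y) rk; first by apply: FA; right.
by exists m, n; rewrite mz nz.
Qed.

(** * The strategy of the cop and one round of play *)

Definition meets (G : graph) (d : G -> G) (c x : G) : Prop :=
  exists j, `[< cadj c (iter j d x) >].

Definition hit (G : graph) (d : G -> G) (c x : G) : nat :=
  if pselect (meets d c x) is left ex then ex_minn ex else 0%N.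

Lemma hitP (G : graph) (d : G -> G) (c x : G) : meets d c x ->
  cadj c (iter (hit d c x) d x) /\
  forall j, cadj c (iter j d x) -> (hit d c x <= j)%N.
Proof.
rewrite /hit; case: pselect => // ex _; case: ex_minnP => m /asboolP cm mP.
by split=> // j cj; apply: mP; apply/asboolP.
Qed.

Definition chase (G : graph) (d : G -> G) (c x : G) : G :=
  if pselect (meets d c x) then iter (hit d c x) d x else d c.

Lemma chase_meets (G : graph) (d : G -> G) (c x : G) :
  meets d c x -> chase d c x = iter (hit d c x) d x.
Proof. by rewrite /chase; case: pselect. Qed.

Lemma chase_cadj (G : graph) (d : G -> G) (c x : G) :
  exhausted d -> cadj c (chase d c x).
Proof.
rewrite /chase => dE; case: pselect => [mx|nmx]; first by case: (hitP mx).
exact: exhausted_cadj.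
Qed.

(* The fixed-point hypothesis excludes the root from the orbit strictly before
   the hit, since a fixed root would already be the vertex that is hit. *)
Lemma hit_neq_root (G : graph) (d : G -> G) (c x z : G) b :
  meets d c x -> (b < hit d c x)%N -> (iter b d x = z -> d z = z) ->
  iter b d x <> z.
Proof.
move=> /hitP[ch hmin] bh fz bz; have dz := fz bz.
have : cadj c (iter b d x).
  move: ch; rewrite -(subnK (ltnW bh)) iterD bz.
  by rewrite (_ : iter _ d z = z)//; elim: (_ - _)%N => //= n ->.
by move=> /hmin; rewrite leqNgt bh.
Qed.

(** Let [s] precede the hit vertex on the orbit of [x], so the cop lands on [d s]. Retracting onto
    the segment ending at [s] sends [y] to a neighbour of [s] or [s] itself, hence by domination to
    a vertex within reach of [d s]. Earlier points on the orbit of [y] lie above [s]; by minimality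
    of [hit] the new predecessor is one of them. *)
Lemma meets_step (G : graph) (A : set G) (z : G) d idx c x y :
  ranked A z d idx -> A x -> A y -> cadj x y ->
  (forall b, (b < hit d c x)%N -> iter b d x = z -> d z = z) ->
  meets d c x -> (0 < hit d c x)%N ->
  meets d (chase d c x) y /\
  ((0 < hit d (chase d c x) y)%N ->
   (idx (iter (hit d c x).-1 d x) <
    idx (iter (hit d (chase d c x) y).-1 d y))%N).
Proof.
move=> rk Ax Ay xy fz mx h_gt0.
have nz b : (b < hit d c x)%N -> iter b d x <> z.
  by move=> bh; apply: hit_neq_root mx bh (fz b bh).
rewrite (chase_meets mx); case: (hit d c x) h_gt0 nz => // h _ nz /=.
have [j [Aj cj lej ltj]] := ranked_retract (a := h) rk Ax Ay xy nz.
have [As _] := ranked_iter (n := h) rk Ax (fun b bh => nz b (ltnW bh)).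
have {}cj := ranked_dom rk As (nz h (ltnSn h)) Aj lej cj.
have my : meets d (d (iter h d x)) y by exists j; apply/asboolP.
split=> // h'_gt0; have [_ /(_ j cj) h'_le] := hitP my.
by apply: ltj; lia.
Qed.

(** * Counting the visits to a vertex *)

Lemma visits_finite (G : graph) (d : G -> G) (c r : nat -> G) (x : G) :
  exhausted d -> (forall n, c n.+1 = chase d (c n) (r n)) ->
  (forall n, cadj (r n) (r n.+1)) -> (forall n, c n.+1 <> r n) ->
  finite_set [set n | r n = x].
Proof.
move=> dE cS rS nocap; apply: contrapT => inf.
have visit N : exists2 n, (N <= n)%N & r n = x.
  apply: contrapT => nN; apply: inf; apply: sub_finite_set (finite_II N).
  move=> n /= rn; rewrite ltnNge; apply: contra_notN nN => Nn.
  by exists n.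
pose m n := hit d (c n) (r n).
have m_gt0 n : meets d (c n) (r n) -> (0 < m n)%N.
  move=> mn; rewrite lt0n; apply: contra_notN (nocap n) => /eqP mn0.
  by rewrite cS chase_meets// -/(m n) mn0.
(* Without a meeting the cop runs along his own orbit, which merges with that of [x]; any visit to
   [x] after the merge is a meeting. *)
have [n0 meet0] : exists n, meets d (c n) (r n).
  apply: contrapT => nomeet.
  have cE n : c n = iter n d (c 0%N).
    elim: n => //= n <-; rewrite cS /chase; case: pselect => // mn.
    by exfalso; apply: nomeet; exists n.
  have [a [b ab]] := exhausted_merge x (c 0%N) dE.
  have [n bn rn] := visit b; apply: nomeet; exists n, (n - b + a)%N.
  apply/asboolP; rewrite cE rn iterD ab -iterD subnK//; exact: cadjxx.
have meet n : (n0 <= n)%N -> meets d (c n) (r n).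
  move=> /subnK <-; elim: (n - n0)%N => [|k IH] //; rewrite addSn cS.
  set i := (k + n0)%N in IH *.
  have [|A [z [idx [FA rk fz]]]] := dE
      ([set r i.+1] `|` (fun b => iter b d (r i)) @` `I_(m i).+1).
    rewrite finite_setU; split; first exact: finite_set1.
    by apply: finite_image; exact: finite_II.
  have [||b bm bz|] := meets_step (c := c i) rk _ _ (rS i) _ IH (m_gt0 i IH).
  - by apply: FA; right; exists 0%N.
  - by apply: FA; left.
  - by apply: fz; right; exists b => //=; apply: ltnW.
  - by [].
have decr n1 n2 : (n0 <= n1)%N -> (n1 < n2)%N -> r n1 = x -> r n2 = x ->
    (m n2 < m n1)%N.
  move=> n01 n12 r1 r2.
  (* One subgraph holds the orbit segments of all rounds up to [n2], which makes their indices
     comparable. *)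
  have [|A [z [idx [FA rk fz]]]] := dE (\bigcup_(k in `I_n2.+1)
      ((fun b => iter b d (r k)) @` `I_(m k).+1)).
    apply: bigcup_finite => [|k _]; first exact: finite_II.
    by apply: finite_image; exact: finite_II.
  have Ar k b : (k <= n2)%N -> (b <= m k)%N -> A (iter b d (r k)).
    by move=> kn bm; apply: FA; exists k => //; exists b.
  have fzr k b : (k <= n2)%N -> (b < m k)%N -> iter b d (r k) = z -> d z = z.
    move=> kn bm bz; apply: fz; exists k => //; exists b => //=.
    exact: ltnW.
  pose rank k := idx (iter (m k).-1 d (r k)).
  have rankS k : (n0 <= k)%N -> (k < n2)%N -> (rank k < rank k.+1)%N.
    move=> n0k kn; have mk := meet k n0k; have mk1 := meet k.+1 (leqW n0k).
    have [||b bm bz|_] := meets_step (c := c k) rk _ _ (rS k) _ mk (m_gt0 k mk).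
    - by apply: (Ar k 0%N) => //; exact: ltnW.
    - exact: (Ar k.+1 0%N).
    - exact: (fzr k b (ltnW kn) bm bz).
    - by rewrite -cS; apply; exact: m_gt0.
  have rank_lt : (rank n1 < rank n2)%N.
    suff mono k : (n1 < k)%N -> (k <= n2)%N -> (rank n1 < rank k)%N.
      exact: mono.
    elim: k => // k IH; rewrite ltnS leq_eqVlt => /predU1P[<-|n1k] kn.
      exact: rankS.
    have n0k : (n0 <= k)%N by lia.
    exact: ltn_trans (IH n1k (ltnW kn)) (rankS k n0k kn).
  (* Both predecessors lie on the orbit of [x], and the index falls along it: if [m n2] were not
     smaller, [rank n2] could not exceed [rank n1]. *)
  rewrite ltnNge; apply/negP => m12; move: rank_lt.
  have m1_gt0 := m_gt0 n1 (meet n1 n01).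
  rewrite /rank r1 r2.
  have -> : ((m n2).-1 = (m n2).-1 - (m n1).-1 + (m n1).-1)%N by lia.
  rewrite iterD.
  have [|b bm|_] := ranked_iter (x := iter (m n1).-1 d x)
    (n := (m n2).-1 - (m n1).-1) rk.
  - by rewrite -r1; apply: Ar; lia.
  - rewrite -iterD -r2; have bm2 : (b + (m n1).-1 < m n2)%N by lia.
    apply: hit_neq_root bm2 (fzr n2 _ (leqnn _) bm2).
    by apply: meet; lia.
  - by lia.
(* Infinite descent: each visit has a later one with smaller [m], so [m] at a visit would exceed
   every [M]. *)
have no_visit M n : (n0 <= n)%N -> r n = x -> (M < m n)%N.
  elim: M n => [|M IH] n n0n rn; first exact: m_gt0 (meet n n0n).
  have [n' nn' rn'] := visit n.+1.
  have := decr n n' n0n nn' rn rn'; apply: leq_ltn_trans.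
  by apply: IH => //; lia.
have [n n0n rn] := visit n0.
by have := no_visit (m n) n n0n rn; rewrite ltnn.
Qed.

Theorem theorem5 (G : graph) (hG : consistently_locally_constructible G) :
  weak_cop_win G.
Proof.
have [d dE] := clc_exhausted hG.
have [_ [v _]] := hG.
(* Histories are never empty, so [last] returns the current positions and not its default. *)
exists (v 0%N), (fun s => let p := last (v 0%N, v 0%N) s in chase d p.1 p.2).
move=> c r [_ cS] rS.
have {}cS n : c n.+1 = chase d (c n) (r n).
  by rewrite cS mkseqS last_rcons.
split; first by move=> n; rewrite [c n.+1]cS; exact: chase_cadj.
have [cap|nocap] := pselect (exists n, c n.+1 = r n); first by left.
right=> x; apply: visits_finite dE cS rS _ => n cn.
by apply: nocap; exists n.
Qed.
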